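(* Let $G$ be the disjointness graph of a finite family of (possibly self-intersecting) $2$-way infinite polygonal $3$-chains in the plane. Then $\chi(G)\le \omega(G)^3+\omega(G)$.
   Context: A $2$-way infinite polygonal $3$-chain is a continuous curve in the plane consisting of a closed half-line, a straight-line segment, and a closed half-line, where the segment shares one endpoint with each half-line. The disjointness graph of a family of subsets of the plane has the members as vertices, two adjacent if and only if they are disjoint. $\chi(G)$ and $\omega(G)$ denote the chromatic number and clique number of $G$. *)

(* Defs.v *)
From mathcomp Require Import all_boot all_order all_algebra.
From mathcomp Require Import boolp classical_sets reals.
Set Implicit Arguments. Unset Strict Implicit. Unset Printing Implicit Defensive.
Import Order.TTheory GRing.Theory Num.Theory.
Local Open Scope ring_scope.
Local Open Scope classical_set_scope.

Section Geometry.
Variable R : realType.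
Definition plane := (R * R)%type.

Definition halfline (p u : plane) : set plane :=
  [set x | exists t : R, 0 <= t /\ x = (p.1 + t * u.1, p.2 + t * u.2)].

Definition segment (p q : plane) : set plane :=
  [set x | exists t : R, 0 <= t <= 1 /\
     x = (p.1 + t * (q.1 - p.1), p.2 + t * (q.2 - p.2))].

Definition is_3chain (S : set plane) : Prop :=
  exists p q u v : plane, p <> q /\ u <> (0, 0) /\ v <> (0, 0) /\
    S = halfline p u `|` segment p q `|` halfline q v.
End Geometry.

Section Graphs.
Variable T : finType.
Variable e : rel T.

Definition is_clique (S : {set T}) : bool :=
  [forall x in S, forall y in S, (x != y) ==> e x y].

Definition clique_number : nat := \max_(S : {set T} | is_clique S) #|S|.

Definition colorable (k : nat) : bool :=
  [exists f : {ffun T -> 'I_k}, forall x, forall y, e x y ==> (f x != f y)].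

(* least k such that a proper k-colouring exists (k = #|T| always works) *)
Definition chromatic_number : nat :=
  \big[minn/#|T|]_(k < #|T|.+1 | colorable k) k.
End Graphs.

Definition disjointness_graph (R : realType) (T : finType)
  (F : T -> set (plane R)) : rel T :=
  fun i j => (i != j) && `[< F i `&` F j = set0 >].

(* Main.v *)
Require Import Defs.
From mathcomp Require Import all_boot all_order all_algebra.
From mathcomp Require Import boolp classical_sets reals.
From mathcomp Require Import topology normedtype.
From mathcomp Require Import ring lra.
Import Order.TTheory GRing.Theory Num.Theory numFieldNormedType.Exports.
Set Implicit Arguments. Unset Strict Implicit. Unset Printing Implicit Defensive.

(** After a shear no half-line or segment is vertical. A chain whose two ends go
    in opposite horizontal directions separates the plane, so on these chains
    disjointness is the comparability relation of a single partial order
    ("above"), and [omega] colours suffice.  Every other chain is a wedge: over a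
    closed vertical half-plane it is the union of two graphs which agree on the
    boundary line.  Disjointness of wedges is the comparability relation of the
    union of three partial orders: "inside", and "above" restricted to pairs
    that increase, respectively decrease, along a preorder of the boundary lines.
    Each order is coloured by height with [omega] colours, whence [omega ^ 3]. *)

(** * Colouring by partial orders *)

Section Colouring.
Variables (T : finType) (e : rel T).

Lemma chromatic_number_le k : colorable e k -> chromatic_number e <= k.
Proof.
move=> ck; rewrite /chromatic_number.
rewrite -big_filter; set s := [seq _ <- _ | _].
(* A [k] above [#|T|] is outside the range of the minimum; the default value [#|T|] then gives the
   bound. *)
have [kT|/ltnW Tk] := leqP k #|T|; last first.
  elim: s => [|j s IH]; first by rewrite big_nil.
  by rewrite big_cons (leq_trans (geq_minr _ _)).
have : Ordinal (kT : k < #|T|.+1) \in s by rewrite mem_filter ck mem_index_enum.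
elim: s => [//|j s IH]; rewrite inE big_cons => /predU1P[<-|/IH]; first exact: geq_minl.
exact: leq_trans (geq_minr _ _).
Qed.

(* The witness is the length of the longest chain strictly below [x]. *)
Lemma order_height (lt : rel T) : transitive lt ->
  (forall x y, lt x y -> e x y && e y x) -> irreflexive e ->
  exists h : T -> 'I_(clique_number e), forall x y, lt x y -> h x != h y.
Proof.
move=> ltT lte eI.
(* [S] is a clique of [e] rather than a chain: [lt] implies adjacency both ways, so adding [x] keeps
   it a clique. This gives both the bound on [h x] and the growth of [h] along [lt]. *)
pose P x (S : {set T}) := [forall y in S, lt y x] && is_clique e S.
have ltI x : lt x x = false by apply/negP => /lte; rewrite eI.
have PU x S : P x S -> is_clique e (x |: S) /\ #|x |: S| = #|S|.+1.
  move=> /andP[/forall_inP Sx /forall_inP cS]; split.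
    apply/forall_inP => y yS; apply/forall_inP => z zS; apply/implyP.
    move: yS zS; rewrite !inE => /predU1P[->|yS] /predU1P[->|zS]; rewrite ?eqxx //.
    - by have /lte/andP[] := Sx z zS.
    - by have /lte/andP[] := Sx y yS.
    - by move/forall_inP/(_ z zS)/implyP: (cS y yS).
  by rewrite cardsU1; case: (boolP (x \in S)) => // /Sx; rewrite ltI.
pose h x := \max_(S : {set T} | P x S) #|S|.
have P0 x : P x finset.set0 by apply/andP; split; apply/forall_inP => y; rewrite finset.in_set0.
have hP x : exists2 S, P x S & h x = #|S|.
  by have [S PS hS] := eq_bigmax_cond (fun S : {set T} => #|S|)
    (introT card_gt0P (ex_intro (fun S => S \in P x) _ (P0 x))); exists S.
have hlt x : h x < clique_number e.
  have [S /PU[cS sS] ->] := hP x; rewrite -sS /clique_number.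
  exact: (@leq_bigmax_cond _ (is_clique e) (fun S : {set T} => #|S|)).
exists (fun x => Ordinal (hlt x)) => x y xy; rewrite -val_eqE /= ltn_eqF //.
have [S PxS ->] := hP x; have [cS <-] := PU _ _ PxS.
apply: (@leq_bigmax_cond _ (P y) (fun S : {set T} => #|S|)).
rewrite /P cS andbT; apply/forall_inP => z; rewrite !inE => /predU1P[->//|zS].
by move/andP: PxS => [/forall_inP/(_ z zS) zx _]; apply: ltT xy.
Qed.

(** Members of [P] are coloured by their height in [lt0], the others by the triple of heights in
    [lt1], [lt2], [lt3]. The colours form a disjoint sum, so only edges within one class need an
    order. *)
Lemma chromatic_number_orders (P : pred T) (lt0 lt1 lt2 lt3 : rel T) :
  irreflexive e -> symmetric e ->
  transitive lt0 -> transitive lt1 -> transitive lt2 -> transitive lt3 ->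
  subrel lt0 e -> subrel lt1 e -> subrel lt2 e -> subrel lt3 e ->
  (forall x y, P x -> P y -> e x y -> lt0 x y || lt0 y x) ->
  (forall x y, ~~ P x -> ~~ P y -> e x y ->
     [\/ lt1 x y || lt1 y x, lt2 x y || lt2 y x | lt3 x y || lt3 y x]) ->
  chromatic_number e <= clique_number e ^ 3 + clique_number e.
Proof.
move=> eI eS T0 T1 T2 T3 S0 S1 S2 S3 eP eN.
have ht (lt : rel T) : transitive lt -> subrel lt e ->
    exists h : T -> 'I_(clique_number e), forall x y, lt x y || lt y x -> h x != h y.
  move=> ltT lte; have [|h hP] := order_height ltT _ eI.
    by move=> x y /lte xy; rewrite -(eS x y) xy.
  by exists h => x y /orP[/hP//|/hP]; rewrite eq_sym.
have [h0 H0] := ht _ T0 S0; have [h1 H1] := ht _ T1 S1.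
have [h2 H2] := ht _ T2 S2; have [h3 H3] := ht _ T3 S3.
pose w := clique_number e.
pose c x : ('I_w * 'I_w * 'I_w) + 'I_w :=
  if P x then inr (h0 x) else inl (h1 x, h2 x, h3 x).
have cP x y : e x y -> c x != c y.
  rewrite /c => exy; case: ifPn => Px; case: ifPn => Py //; apply/eqP => -[].
  - by apply/eqP/H0/eP.
  - move=> c1 c2 c3; have := eN x y Px Py exy.
    by case=> [/H1|/H2|/H3] /eqP.
have <- : #|{: ('I_w * 'I_w * 'I_w) + 'I_w}| = w ^ 3 + w.
  by rewrite card_sum !card_prod !card_ord !expnS expn0 muln1 mulnA.
apply: chromatic_number_le; apply/existsP; exists [ffun x => enum_rank (c x)].
apply/forallP => x; apply/forallP => y; apply/implyP => /cP; rewrite !ffunE.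
by apply: contra_neq; exact: enum_rank_inj.
Qed.
End Colouring.

Section Plane.
Local Open Scope ring_scope.
Local Open Scope classical_set_scope.
Variable R : realType.
Implicit Types (A B C : set (plane R)) (f g h : R -> R) (a b x y t : R).

(** * Continuous functions on the line *)

Lemma contD f g : continuous f -> continuous g -> continuous (fun t => f t + g t).
Proof. by move=> cf cg t; apply: cvgD; [exact: cf|exact: cg]. Qed.
Lemma contN f : continuous f -> continuous (fun t => - f t).
Proof. by move=> cf t; apply: cvgN; exact: cf. Qed.
Lemma contM f g : continuous f -> continuous g -> continuous (fun t => f t * g t).
Proof. by move=> cf cg t; apply: cvgM; [exact: cf|exact: cg]. Qed.
Lemma cont_max f g : continuous f -> continuous g ->
  continuous (fun t => Num.max (f t) (g t)).
Proof. by move=> cf cg t; apply: (@continuous_max _ _ f g); [exact: cf|exact: cg]. Qed.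
Lemma cont_min f g : continuous f -> continuous g ->
  continuous (fun t => Num.min (f t) (g t)).
Proof. by move=> cf cg t; apply: (@continuous_min _ _ f g); [exact: cf|exact: cg]. Qed.

Ltac cont := lazymatch goal with
  | |- continuous (fun t => @?f t + @?g t) => apply: (contD (f := f) (g := g)); cont
  | |- continuous (fun t => @?f t * @?g t) => apply: (contM (f := f) (g := g)); cont
  | |- continuous (fun t => - @?f t) => apply: (contN (f := f)); cont
  | |- continuous (fun t => Num.max (@?f t) (@?g t)) => apply: (cont_max (f := f) (g := g)); cont
  | |- continuous (fun t => Num.min (@?f t) (@?g t)) => apply: (cont_min (f := f) (g := g)); cont
  | |- continuous (fun t => t) => by move=> ?; exact: cvg_id
  | |- continuous (fun _ => ?c) => exact: cst_continuous
  | _ => assumption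
  end.

(** By the intermediate value theorem, a change of sign would force a zero. *)
Lemma sgr_const f a b : continuous f ->
  (forall x, Num.min a b <= x <= Num.max a b -> f x != 0) -> Num.sg (f a) = Num.sg (f b).
Proof.
move=> cf; wlog ab : a b / a <= b => [H|].
  have /orP[ab|ba] := le_total a b; first exact: H.
  by move=> nz; symmetry; apply: H => // x; rewrite minC maxC; exact: nz.
rewrite (min_idPl ab) (max_idPr ab) => nz.
have fa : f a != 0 by rewrite nz // lexx.
have fb : f b != 0 by rewrite nz // lexx ab.
have [mid|] := boolP (Num.min (f a) (f b) <= 0 <= Num.max (f a) (f b)).
  have [|c + fc0] := @IVT R f a b 0 ab _ mid; first exact: continuous_subspaceT.
  by rewrite in_itv /= => /nz; rewrite fc0 eqxx.
rewrite ge_min le_max negb_and !negb_or -!ltNge => /orP[]/andP[].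
  by move=> a0 b0; rewrite !gtr0_sg.
by move=> a0 b0; rewrite !ltr0_sg.
Qed.

(** * Wedges *)

Definition disj A B := forall x y, A (x, y) -> B (x, y) -> False.
(** Vacuous when no vertical line meets both sets, hence not transitive by itself. *)
Definition above A B := forall x y y', A (x, y) -> B (x, y') -> y' < y.
Definition inside A B := forall x y, A (x, y) -> exists y1 y2,
  [/\ y1 < y, y < y2 & forall y', B (x, y') <-> y' = y1 \/ y' = y2].

Definition side (r : bool) a x := if r then a <= x else x <= a.
(** [r] is [true] for a wedge opening to the right. The arms [f] and [g] share the apex over [a] and
    may meet again, since chains may cross themselves. *)
Definition wedge A (r : bool) a := exists f g, [/\ continuous f, continuous g, f a = g a &
  forall x y, A (x, y) <-> side r a x /\ (y = f x \/ y = g x)].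

Lemma above_disj A B : above A B -> disj A B.
Proof. by move=> AB x y Ax /(AB _ _ _ Ax); rewrite ltxx. Qed.

Lemma inside_disj A B : inside A B -> disj A B.
Proof.
move=> AB x y /AB[y1 [y2 [y1y yy2 BE]]] /BE[]ye.
  by rewrite ye ltxx in y1y.
by rewrite ye ltxx in yy2.
Qed.

(** The two points of [B] around a point of [A] see the same section of [C], and each lies strictly
    between its two points; so does everything between them. *)
Lemma inside_trans A B C : inside A B -> inside B C -> inside A C.
Proof.
move=> AB BC x y /AB[y1 [y2 [y1y yy2 BE]]].
have /BC[z1 [z2 [z11 z12 CE]]] : B (x, y1) by apply/BE; left.
have /BC[z1' [z2' [z11' z12' CE']]] : B (x, y2) by apply/BE; right.
exists z1, z2; split => //; first exact: lt_trans y1y.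
have /CE'[e|e] : C (x, z2) by apply/CE; right.
  have /CE'[e'|e'] : C (x, z1) by apply/CE; left.
    by move: (lt_trans z11 z12); rewrite e e' ltxx.
  by have := lt_trans z11 z12; have := lt_trans z11' z12'; rewrite e e'; lra.
by rewrite e; exact: lt_trans z12'.
Qed.

(** On every vertical line that meets [A] and [C], the first hypothesis supplies a point of [B] to
    compare through. *)
Lemma above_trans A B C :
  (forall x y y'', A (x, y) -> C (x, y'') -> exists y', B (x, y')) ->
  above A B -> above B C -> above A C.
Proof.
move=> H AB BC x y y'' Ax Cx; have [y' Bx] := H _ _ _ Ax Cx.
by apply: lt_trans (BC _ _ _ Bx Cx) (AB _ _ _ Ax Bx).
Qed.

Lemma side_between r a b c x : side r a b -> side r a c ->
  Num.min b c <= x <= Num.max b c -> side r a x.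
Proof. by case: r => /=; rewrite ge_min le_max; lra. Qed.

(** A zero of [h - h'] between [a] and [b] would be a common point of [A] and [B], so the sign of
    the difference is constant. *)
Lemma graphs_order A B h h' a b : continuous h -> continuous h' -> disj A B ->
  (forall x, Num.min a b <= x <= Num.max a b -> A (x, h x) /\ B (x, h' x)) ->
  (h' a < h a) = (h' b < h b) /\ (h a < h' a) = (h b < h' b).
Proof.
move=> ch ch' AB hAB.
have sE : Num.sg (h a - h' a) = Num.sg (h b - h' b).
  apply: (sgr_const (f := fun t => h t - h' t)); first by cont.
  move=> z /hAB[Az Bz]; rewrite subr_eq0; apply/eqP => e.
  by apply: (AB z (h z)); rewrite // e.
split; first by rewrite -subr_gt0 -sgr_gt0 sE sgr_gt0 subr_gt0.
by rewrite -subr_lt0 -sgr_lt0 sE sgr_lt0 subr_lt0.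
Qed.

(** [side r b a] puts the half-plane of [A] inside that of [B]. The position of the apex of [A]
    relative to the arms of [B] is carried by [graphs_order] to the whole half-plane of [A]. *)
Lemma wedge_same A B r a b : wedge A r a -> wedge B r b -> side r b a -> disj A B ->
  [\/ above A B, above B A | inside A B].
Proof.
move=> [f [g [cf cg fga AE]]] [f' [g' [cf' cg' fgb BE]]] ba AB.
have sub x : side r a x -> side r b x by case: (r) ba => /=; lra.
have aa : side r a a by case: (r) => /=.
have key h h' x : continuous h -> continuous h' ->
    (forall x, side r a x -> A (x, h x)) -> (forall x, side r b x -> B (x, h' x)) ->
    side r a x -> (h' a < h a) = (h' x < h x) /\ (h a < h' a) = (h x < h' x).
  move=> ch ch' Ah Bh ax; apply: (graphs_order ch ch' AB) => z.
  by move=> /(side_between aa ax) az; split; [exact: Ah|exact/Bh/sub].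
have Af x : side r a x -> A (x, f x) by move=> ?; apply/AE; tauto.
have Ag x : side r a x -> A (x, g x) by move=> ?; apply/AE; tauto.
have Bf x : side r b x -> B (x, f' x) by move=> ?; apply/BE; tauto.
have Bg x : side r b x -> B (x, g' x) by move=> ?; apply/BE; tauto.
have lt_f : f a != f' a.
  by apply/eqP => e; apply: (AB a (f a)); [exact: Af|rewrite e; exact/Bf/sub].
have lt_g : f a != g' a.
  by apply/eqP => e; apply: (AB a (f a)); [exact: Af|rewrite e; exact/Bg/sub].
have K x (ax : side r a x) : [/\
    ((f' a < f a) = (f' x < f x)) * ((f a < f' a) = (f x < f' x)),
    ((f' a < f a) = (f' x < g x)) * ((f a < f' a) = (g x < f' x)),
    ((g' a < f a) = (g' x < f x)) * ((f a < g' a) = (f x < g' x)) &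
    ((g' a < f a) = (g' x < g x)) * ((f a < g' a) = (g x < g' x))]%type.
  have [? ?] := key f f' x cf cf' Af Bf ax; have [? ?] := key f g' x cf cg' Af Bg ax.
  have [] := key g f' x cg cf' Ag Bf ax; have [] := key g g' x cg cg' Ag Bg ax.
  by rewrite -fga.
(* The apex is below both arms of [B], between them in one of two orders, or above both. *)
move: lt_f lt_g; rewrite !neq_lt => /orP[]lf /orP[]lg.
- apply: Or32 => x y y' /BE[bx By] /AE[ax Ay]; have [k1 k2 k3 k4] := K x ax.
  by case: Ay By => -> [] ->; rewrite -?k1 -?k2 -?k3 -?k4.
- apply: Or33 => x y /AE[ax Ay]; exists (g' x), (f' x); have [k1 k2 k3 k4] := K x ax.
  have bx := sub x ax; split; last by move=> y'; rewrite BE; tauto.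
    by case: Ay => ->; rewrite -?k3 -?k4.
  by case: Ay => ->; rewrite -?k1 -?k2.
- apply: Or33 => x y /AE[ax Ay]; exists (f' x), (g' x); have [k1 k2 k3 k4] := K x ax.
  have bx := sub x ax; split; last by move=> y'; rewrite BE; tauto.
    by case: Ay => ->; rewrite -?k1 -?k2.
  by case: Ay => ->; rewrite -?k3 -?k4.
- apply: Or31 => x y y' /AE[ax Ay] /BE[bx By]; have [k1 k2 k3 k4] := K x ax.
  by case: Ay By => -> [] ->; rewrite -?k1 -?k2 -?k3 -?k4.
Qed.

(** Either the half-planes are disjoint and the claim is vacuous, or they overlap in a strip. There
    the arms of [A] meet over [a] and those of [B] over [b], which ties all four comparisons of arms
    together. *)
Lemma wedge_opposite A B a b : wedge A true a -> wedge B false b -> disj A B ->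
  above A B \/ above B A.
Proof.
move=> [f [g [cf cg fga AE]]] [f' [g' [cf' cg' fgb BE]]] AB.
have [ba|ab] := ltP b a; first by left => x y y' /AE[/= ax _] /BE[/= bx _]; lra.
have key h h' x x' : continuous h -> continuous h' ->
    (forall x, side true a x -> A (x, h x)) -> (forall x, side false b x -> B (x, h' x)) ->
    a <= x <= b -> a <= x' <= b ->
    (h' x < h x) = (h' x' < h x') /\ (h x < h' x) = (h x' < h' x').
  move=> ch ch' Ah Bh ax bx; apply: (graphs_order ch ch' AB) => z.
  by rewrite ge_min le_max => zx; split; [apply: Ah|apply: Bh] => /=; lra.
have Af x : side true a x -> A (x, f x) by move=> ?; apply/AE; tauto.
have Ag x : side true a x -> A (x, g x) by move=> ?; apply/AE; tauto.
have Bf x : side false b x -> B (x, f' x) by move=> ?; apply/BE; tauto.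
have Bg x : side false b x -> B (x, g' x) by move=> ?; apply/BE; tauto.
have aab : a <= a <= b by rewrite lexx.
have bab : a <= b <= b by rewrite lexx andbT.
have neq : f a != f' a.
  by apply/eqP => e; apply: (AB a (f a)); [apply: Af => /=|rewrite e; apply: Bf].
have K x (ax : a <= x <= b) : [/\
    ((f' a < f a) = (f' x < f x)) * ((f a < f' a) = (f x < f' x)),
    ((f' a < f a) = (f' x < g x)) * ((f a < f' a) = (g x < f' x)),
    ((f' a < f a) = (g' x < f x)) * ((f a < f' a) = (f x < g' x)) &
    ((f' a < f a) = (g' x < g x)) * ((f a < f' a) = (g x < g' x))]%type.
  (* A comparison with [g'] at [x] is moved to [b], where [g'] equals [f'], and then to [a], where
     [g] equals [f]. *)
  have [ff ff'] := key f f' a b cf cf' Af Bf aab bab.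
  have [fg fg'] := key f g' x b cf cg' Af Bg ax bab.
  have [gf gf'] := key g f' a b cg cf' Ag Bf aab bab.
  have [gg gg'] := key g g' x b cg cg' Ag Bg ax bab.
  have [? ?] := key f f' a x cf cf' Af Bf aab ax.
  have [? ?] := key g f' a x cg cf' Ag Bf aab ax.
  rewrite -fgb in fg fg' gg gg'; rewrite -fga in gf gf'.
  by split; split; congruence.
move: neq; rewrite neq_lt => /orP[]lf; [right|left].
- move=> x y y' /BE[/= bx By] /AE[/= ax Ay]; have [|k1 k2 k3 k4] := K x; first by rewrite ax.
  by case: Ay By => -> [] ->; rewrite -?k1 -?k2 -?k3 -?k4.
- move=> x y y' /AE[/= ax Ay] /BE[/= bx By]; have [|k1 k2 k3 k4] := K x; first by rewrite ax.
  by case: Ay By => -> [] ->; rewrite -?k1 -?k2 -?k3 -?k4.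
Qed.

(* Left wedges come before right wedges; along this order a vertical line
   meeting the two outer wedges also meets the middle one. *)
Definition le_end (r : bool) a (r' : bool) b := if r == r' then a <= b else r'.

Lemma le_end_trans ra a rb b rc c :
  le_end ra a rb b -> le_end rb b rc c -> le_end ra a rc c.
Proof. by case: ra rb rc => [] [] [] //=; exact: le_trans. Qed.

Lemma side_middle ra a rb b rc c x : le_end ra a rb b -> le_end rb b rc c ->
  side ra a x -> side rc c x -> side rb b x.
Proof. by case: ra rb rc => [] [] [] //; rewrite /le_end /side /=; lra. Qed.

Lemma wedge_side A r a x y : wedge A r a -> A (x, y) -> side r a x.
Proof. by move=> [f [g [_ _ _ AE]]] /AE[]. Qed.
Lemma side_wedge A r a x : wedge A r a -> side r a x -> exists y, A (x, y).
Proof. by move=> [f [g [_ _ _ AE]]] ax; exists (f x); apply/AE; tauto. Qed.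

(** * Chains going from left to right *)

(* [phi] vanishes exactly on [A], so its sign tells on which side of [A] a point
   lies; far to the left [A] is the graph of [L] and [phi] is positive above it. *)
Definition crossing A := exists (phi : R -> R -> R) X Y L M, [/\
  forall f g, continuous f -> continuous g -> continuous (fun t => phi (f t) (g t)),
  continuous X /\ continuous Y,
  forall x y, A (x, y) <-> exists t, x = X t /\ y = Y t,
  forall x y, A (x, y) <-> phi x y = 0 &
  forall x y, x <= M -> Num.sg (phi x y) = Num.sg (y - L x)].

(** Heights are compared only far to the left, where crossings are graphs; disjointness extends the
    comparison to the rest of the curves. *)
Definition over A B := disj A B /\
  exists M, forall x y y', x <= M -> A (x, y) -> B (x, y') -> y' < y.

Lemma disjC A B : disj A B -> disj B A.
Proof. by move=> AB x y Bx Ax; exact: AB Ax Bx. Qed.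

Lemma crossing_left A : crossing A ->
  exists L M, forall x y, x <= M -> A (x, y) <-> y = L x.
Proof.
move=> [phi [X [Y [L [M [_ _ _ A0 sL]]]]]]; exists L, M => x y xM; rewrite A0.
split=> [p0|->]; last by apply/eqP; rewrite -sgr_eq0 sL // subrr sgr0.
by apply/eqP; rewrite -subr_eq0 -sgr_eq0 -sL // p0 sgr0.
Qed.

(* [s] is constant on a crossing [A] disjoint from [B], by connectedness, so its
   value can be read off far to the left. *)
Lemma over_side B : crossing B -> exists s : R -> R -> R,
  (forall x y, B (x, y) <-> s x y = 0) /\
  forall A, crossing A ->
    [/\ over A B -> forall x y, A (x, y) -> s x y = 1,
        over B A -> forall x y, A (x, y) -> s x y = -1 &
        disj A B -> over A B \/ over B A].
Proof.
move=> cB; have [phi [_ [_ [L [M [cphi _ _ B0 sL]]]]]] := cB.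
exists (fun x y => Num.sg (phi x y)); split=> [x y|A cA].
  by rewrite B0; split => [->|/eqP]; [rewrite sgr0|rewrite sgr_eq0 => /eqP].
have [LA [MA AL]] := crossing_left cA.
have sgc : disj A B -> forall x y x' y', A (x, y) -> A (x', y') ->
    Num.sg (phi x y) = Num.sg (phi x' y').
  have [_ [X [Y [_ [_ [_ [cX cY] AE _ _]]]]]] := cA.
  move=> AB x y x' y' /AE[t [-> ->]] /AE[t' [-> ->]].
  apply: (sgr_const (f := fun t => phi (X t) (Y t))); first exact: cphi.
  move=> z _; apply/eqP => /B0; apply: AB; apply/AE; by exists z.
have BL x : x <= M -> B (x, L x).
  by move=> xM; apply/B0/eqP; rewrite -sgr_eq0 sL // subrr sgr0.
split.
- move=> [AB [M' H]] x y Axy; pose x0 := Num.min MA (Num.min M M').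
  have [x1 x2 x3] : [/\ x0 <= MA, x0 <= M & x0 <= M'].
    by rewrite /x0 !ge_min !lexx !orbT.
  have A0 : A (x0, LA x0) by apply/AL.
  rewrite (sgc AB _ _ _ _ Axy A0) sL // gtr0_sg // subr_gt0.
  exact: H A0 (BL _ x2).
- move=> [/disjC AB [M' H]] x y Axy; pose x0 := Num.min MA (Num.min M M').
  have [x1 x2 x3] : [/\ x0 <= MA, x0 <= M & x0 <= M'].
    by rewrite /x0 !ge_min !lexx !orbT.
  have A0 : A (x0, LA x0) by apply/AL.
  rewrite (sgc AB _ _ _ _ Axy A0) sL // ltr0_sg // subr_lt0.
  exact: H (BL _ x2) A0.
(* Left of [x0] both sets are graphs, and the order at [x0] persists on the whole left end. *)
move=> AB; pose x0 := Num.min MA M.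
have [x1 x2] : x0 <= MA /\ x0 <= M by rewrite /x0 !ge_min !lexx !orbT.
have A0 : A (x0, LA x0) by apply/AL.
have sA x y : x <= x0 -> A (x, y) -> Num.sg (y - L x) = Num.sg (LA x0 - L x0).
  move=> xx0 Axy; rewrite -!sL ?(le_trans xx0) //; exact: sgc.
have LB x y : x <= x0 -> B (x, y) -> y = L x.
  move=> xx0 /B0/eqP; rewrite -sgr_eq0 sL ?(le_trans xx0) // sgr_eq0 subr_eq0.
  by move/eqP.
have : LA x0 != L x0.
  by apply/eqP => e; apply: (AB x0 (L x0)); [rewrite -e|exact: BL].
rewrite neq_lt => /orP[]l; [right|left].
  split; first exact: disjC.
  exists x0 => x y y' xx0 /(LB _ _ xx0) -> /(sA _ _ xx0).
  by rewrite (@ltr0_sg _ (LA x0 - _)) ?subr_lt0 // => /eqP; rewrite sgr_cp0 subr_lt0.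
split=> //; exists x0 => x y y' xx0 /(sA _ _ xx0) + /(LB _ _ xx0) ->.
by rewrite (@gtr0_sg _ (LA x0 - _)) ?subr_gt0 // => /eqP; rewrite sgr_cp0 subr_gt0.
Qed.

Lemma over_total A B : crossing A -> crossing B -> disj A B -> over A B \/ over B A.
Proof. by move=> cA /over_side[s [_ /(_ _ cA)[]]]. Qed.

(** [B] separates [A] from [C]: its side function is [1] on [A] and [-1] on [C], so these are
    disjoint. Far to the left the heights are compared through the point of [B]. *)
Lemma over_trans A B C : crossing A -> crossing B -> crossing C ->
  over A B -> over B C -> over A C.
Proof.
move=> cA cB cC AB BC; have [s [_ sP]] := over_side cB.
have [sA _ _] := sP _ cA; have [_ sC _] := sP _ cC; split.
  by move=> x y /(sA AB) + /(sC BC) => ->; lra.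
have [L [M LM]] := crossing_left cB; have [_ [M1 H1]] := AB; have [_ [M2 H2]] := BC.
exists (Num.min M (Num.min M1 M2)) => x y y'; rewrite !le_min => /and3P[xM x1 x2] Ax Cx.
have Bx : B (x, L x) by apply/LM.
exact: lt_trans (H2 _ _ _ x2 Bx Cx) (H1 _ _ _ x1 Ax Bx).
Qed.

(** * Polygonal chains *)

Definition chain (p q u v : plane R) : set (plane R) :=
  halfline p u `|` segment p q `|` halfline q v.

Lemma segmentC (p q : plane R) : segment p q = segment q p.
Proof.
by apply/seteqP; split => z [t [t01 ->]]; exists (1 - t);
   (split; [lra | congr pair; ring]).
Qed.

Lemma chainC (p q u v : plane R) : chain p q u v = chain q p v u.
Proof. by rewrite /chain segmentC setUC (setUC (halfline p u)) setUA. Qed.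

(** The sign condition on the product treats half-lines to the left and to the right at once. *)
Lemma halflineE (p u : plane R) x y : u.1 != 0 ->
  halfline p u (x, y) <-> 0 <= (x - p.1) * u.1 /\ y = p.2 + u.2 / u.1 * (x - p.1).
Proof.
move=> u0; split=> [[t [t0 [-> ->]]]|[x0 ->]].
  split; last by field.
  by rewrite addrAC subrr add0r -mulrA mulr_ge0 // -expr2 sqr_ge0.
exists ((x - p.1) / u.1); split; last by congr pair; field.
have -> : (x - p.1) / u.1 = (x - p.1) * u.1 / u.1 ^+ 2 by field.
by rewrite divr_ge0 // sqr_ge0.
Qed.

Lemma segmentE (p q : plane R) x y : p.1 != q.1 ->
  segment p q (x, y) <-> ((p.1 <= x <= q.1) || (q.1 <= x <= p.1)) /\
    y = p.2 + (q.2 - p.2) / (q.1 - p.1) * (x - p.1).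
Proof.
wlog pq : p q / p.1 < q.1 => [H|_].
  move=> pq; have /orP[lt|lt] : (p.1 < q.1) || (q.1 < p.1) by rewrite -neq_lt.
    exact: H.
  rewrite segmentC H // 1?eq_sym // orbC.
  by apply: and_iff_compat_l; split => ->; field; lra.
have d0 : 0 < q.1 - p.1 by lra.
have dn : q.1 - p.1 != 0 by lra.
have -> : (p.1 <= x <= q.1) || (q.1 <= x <= p.1) = (p.1 <= x <= q.1) by lra.
split=> [[t [t0 [-> ->]]]|[x0 ->]].
  split; last by field.
  by apply/andP; split; nra.
exists ((x - p.1) / (q.1 - p.1)); split; last by congr pair; field.
by rewrite divr_ge0 ?ler_pdivrMr //; lra.
Qed.

Lemma chainE (p q u v : plane R) x y (a1 := u.2 / u.1)
    (a2 := (q.2 - p.2) / (q.1 - p.1)) (a3 := v.2 / v.1) :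
  u.1 != 0 -> v.1 != 0 -> p.1 != q.1 ->
  chain p q u v (x, y) <-> [\/ 0 <= (x - p.1) * u.1 /\ y = p.2 + a1 * (x - p.1),
    ((p.1 <= x <= q.1) || (q.1 <= x <= p.1)) /\ y = p.2 + a2 * (x - p.1) |
    0 <= (x - q.1) * v.1 /\ y = q.2 + a3 * (x - q.1)].
Proof.
move=> u0 v0 pq; have [h1 h1'] := halflineE p x y u0.
have [h2 h2'] := segmentE x y pq; have [h3 h3'] := halflineE q x y v0.
split=> [[[/h1|/h2]|/h3]|[/h1'|/h2'|/h3']]; by [constructor|left; left|left; right|right].
Qed.

(** One arm is the half-line at the apex; the other is the segment continued by the second
    half-line. *)
Lemma chain_wedge (p q u v : plane R) : 0 < u.1 * v.1 -> p.1 != q.1 ->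
  exists r a, wedge (chain p q u v) r a.
Proof.
(* Up to exchanging [p] and [q], the segment leaves [p] in the horizontal direction of the
   half-lines, which makes [p] the apex. *)
move=> uv pq; wlog pu : p q u v uv pq / 0 < (q.1 - p.1) * u.1 => [H|].
  have [/H|qpu] := ltP 0 ((q.1 - p.1) * u.1); first exact.
  rewrite chainC; apply: H; rewrite 1?mulrC 1?eq_sym //.
  have /orP[ul|ul] : (u.1 < 0) || (0 < u.1).
    by rewrite -neq_lt; apply/eqP => e; move: uv; rewrite e; lra.
    have vl : v.1 < 0 by rewrite nmulr_rgt0 in uv.
    by rewrite nmulr_lgt0 //; move: qpu; rewrite nmulr_lle0 //; lra.
  have vl : 0 < v.1 by rewrite pmulr_rgt0 in uv.
  by rewrite pmulr_lgt0 //; move: qpu; rewrite pmulr_lle0 //; lra.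
have u0 : u.1 != 0 by apply/eqP => e; move: uv; rewrite e; lra.
have v0 : v.1 != 0 by apply/eqP => e; move: uv; rewrite e; lra.
have e2 : (q.2 - p.2) / (q.1 - p.1) * (q.1 - p.1) = q.2 - p.2 by field; lra.
have chE x y := @chainE p q u v x y u0 v0 pq.
move: (u.2 / u.1) (v.2 / v.1) (_ / (_ - _)) e2 chE => a1 a3 a2 e2 chE.
move: (u0); rewrite neq_lt => /orP[ul|ul].
  have vl : v.1 < 0 by rewrite nmulr_rgt0 in uv.
  have pql : q.1 < p.1 by rewrite nmulr_lgt0 in pu; lra.
  (* Clamping at [q.1] makes the second arm follow the segment as far as [q] and the half-line
     beyond. *)
  exists false, p.1, (fun x => p.2 + a1 * (x - p.1)).
  exists (fun x => p.2 + a2 * (Num.max x q.1 - p.1) + a3 * (x - Num.max x q.1)).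
  split=> [|||x y]; [by cont|by cont|by rewrite (max_idPl _) 1?ltW //; lra|].
  rewrite chE !nmulr_lge0 // /side; have [xq|xq] := leP x q.1.
    have -> : p.2 + a2 * (q.1 - p.1) + a3 * (x - q.1) = q.2 + a3 * (x - q.1) by lra.
    split=> [[][h e]|[h [] e]]; first by [split; [lra|left]].
    - have xq' : x = q.1 by lra.
      by split; [lra|right; rewrite e xq'; lra].
    - by split; [lra|right].
    - by apply: Or31; split; lra.
    - by apply: Or33; split; lra.
  split=> [[][h e]|[h [] e]]; first by [split; [lra|left]].
  - by split; [lra|right; lra].
  - by lra.
  - by apply: Or31; split; lra.
  - by apply: Or32; split; lra.
have vl : 0 < v.1 by rewrite pmulr_rgt0 in uv.
have pql : p.1 < q.1 by rewrite pmulr_lgt0 in pu; lra.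
exists true, p.1, (fun x => p.2 + a1 * (x - p.1)).
exists (fun x => p.2 + a2 * (Num.min x q.1 - p.1) + a3 * (x - Num.min x q.1)).
split=> [|||x y]; [by cont|by cont|by rewrite (min_idPl _) 1?ltW //; lra|].
rewrite chE !pmulr_lge0 // /side; have [xq|xq] := leP x q.1.
  split=> [[][h e]|[h [] e]]; first by [split; [lra|left]].
  - by split; [lra|right; lra].
  - have xq' : x = q.1 by lra.
    by split; [lra|right; rewrite e xq'; lra].
  - by apply: Or31; split; lra.
  - by apply: Or32; split; lra.
have -> : p.2 + a2 * (q.1 - p.1) + a3 * (x - q.1) = q.2 + a3 * (x - q.1) by lra.
split=> [[][h e]|[h [] e]]; first by [split; [lra|left]].
- by lra.
- by split; [lra|right].
- by apply: Or31; split; lra.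
- by apply: Or33; split; lra.
Qed.
Lemma chain_path (p q u v : plane R) : exists X Y, [/\ continuous X, continuous Y &
  forall x y, chain p q u v (x, y) <-> exists t, x = X t /\ y = Y t].
Proof.
(* One coordinate at time [t]: the first half-line for [t <= 0], the segment for [0 <= t <= 1], the
   second half-line afterwards. The clamped times switch the pieces on and off. *)
pose w (a b c d : R) t := a + Num.max 0 (- t) * c
  + Num.max 0 (Num.min t 1) * (b - a) + Num.max 0 (t - 1) * d.
have wc a b c d : continuous (w a b c d) by rewrite /w; cont.
exists (w p.1 q.1 u.1 v.1), (w p.2 q.2 u.2 v.2); split=> // x y.
have w1 t a b c d : t <= 0 -> w a b c d t = a - t * c.
  by move=> t0; rewrite /w (max_idPr _) 1?(max_idPl _) 1?(max_idPl _) ?ge_min ?t0; lra.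
have w2 t a b c d : 0 <= t <= 1 -> w a b c d t = a + t * (b - a).
  move=> t0; rewrite /w (max_idPl _) 1?(min_idPl _) 1?(max_idPr _) 1?(max_idPl _); lra.
have w3 t a b c d : 1 <= t -> w a b c d t = b + (t - 1) * d.
  move=> t0; rewrite /w (max_idPl _) 1?(min_idPr _) 1?(max_idPr _) 1?(max_idPr _); lra.
split.
  case=> [[]|] [t [t0 [-> ->]]].
  - by exists (- t); rewrite !w1 /= ?oppr_le0 // !mulNr !opprK.
  - by exists t; rewrite !w2.
  - by exists (t + 1); rewrite !w3 ?lerDr // addrK.
case=> t [-> ->]; have [t0|t0] := leP t 0.
  by left; left; exists (- t); rewrite !w1 // !mulNr oppr_ge0.
have [t1|t1] := leP t 1.
  by left; right; exists t; rewrite !w2 ?t1 ?ltW.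
by right; exists (t - 1); rewrite !w3 ?subr_ge0 ?ltW.
Qed.

(** If [p.1 < q.1] the chain is a graph. Otherwise it folds back: [phi] is the product of three line
    equations over the strip from [q.1] to [p.1], and one line equation times a positive factor
    outside it. *)
Lemma chain_crossing (p q u v : plane R) : u.1 < 0 -> 0 < v.1 -> p.1 != q.1 ->
  crossing (chain p q u v).
Proof.
move=> ul vl pq; have [X [Y [cX cY XYE]]] := chain_path p q u v.
have u0 : u.1 != 0 by lra.
have v0 : v.1 != 0 by lra.
have e2 : (q.2 - p.2) / (q.1 - p.1) * (q.1 - p.1) = q.2 - p.2 by field; lra.
have chE x y : chain p q u v (x, y) <->
    [\/ x <= p.1 /\ y = p.2 + u.2 / u.1 * (x - p.1),
      ((p.1 <= x <= q.1) || (q.1 <= x <= p.1)) /\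
        y = p.2 + (q.2 - p.2) / (q.1 - p.1) * (x - p.1) |
      q.1 <= x /\ y = q.2 + v.2 / v.1 * (x - q.1)].
  by rewrite chainE // nmulr_lge0 // pmulr_lge0 // subr_le0 subr_ge0.
move: (u.2 / u.1) (v.2 / v.1) (_ / (_ - _)) e2 chE => a1 a3 a2 e2 chE.
pose l1 x := p.2 + a1 * (x - p.1).
pose l2 x := p.2 + a2 * (x - p.1).
pose l3 x := q.2 + a3 * (x - q.1).
have l1p : l1 p.1 = p.2 by rewrite /l1; lra.
have l2p : l2 p.1 = p.2 by rewrite /l2; lra.
have l2q : l2 q.1 = q.2 by rewrite /l2; lra.
have l3q : l3 q.1 = q.2 by rewrite /l3; lra.
move: (pq); rewrite neq_lt => /orP[pql|qpl].
  (* Outside its own range each clamped piece is constant; [p.2] and [q.2] are subtracted to cancel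
     these constants. *)
  pose F x := l1 (Num.min x p.1) + (l2 (Num.max p.1 (Num.min x q.1)) - p.2)
    + (l3 (Num.max x q.1) - q.2).
  have F1 x : x <= p.1 -> F x = l1 x.
    move=> xp; have xq : x <= q.1 by lra.
    by rewrite /F (min_idPl xp) (min_idPl xq) (max_idPl xp) (max_idPr xq) l2p l3q; lra.
  have F2 x : p.1 <= x <= q.1 -> F x = l2 x.
    move=> /andP[px xq].
    by rewrite /F (min_idPr px) (min_idPl xq) (max_idPr px) (max_idPr xq) l1p l3q; lra.
  have F3 x : q.1 <= x -> F x = l3 x.
    move=> qx; have px : p.1 <= x by lra.
    rewrite /F (min_idPr px) (min_idPr qx) (max_idPr (ltW pql)) (max_idPl qx) l1p l2q.
    lra.
  exists (fun x y => y - F x), X, Y, l1, p.1.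
  split=> [f g cf cg| |//|x y|x y xp]; last by rewrite F1.
  - by rewrite /F /l1 /l2 /l3; cont.
  - by [].
  rewrite chE; split=> [H|/eqP].
    apply/eqP; rewrite subr_eq0; apply/eqP.
    case: H => -[h ->]; first by rewrite F1.
      have /F2-> // : p.1 <= x <= q.1 by case/orP: h => //; lra.
    by rewrite F3.
  rewrite subr_eq0 => /eqP ->.
  have [xp|px] := leP x p.1; first by apply: Or31; rewrite F1.
  have [xq|qx] := leP x q.1; last by apply: Or33; rewrite F3 // ltW.
  by apply: Or32; rewrite F2 ?(ltW px) ?xq.
pose f1 x := l1 (Num.min x p.1).
pose f2 x := l2 (Num.max q.1 (Num.min x p.1)).
pose f3 x := l3 (Num.max x q.1).
(* [f1], [f2], [f3] are the three pieces with clamped arguments. Beyond [p.1] (resp.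
   before [q.1]) two of them are constant with the same value, and the last two
   terms of [phi] keep their squared factor away from [0]. *)
pose phi x y := (y - f1 x) * (y - f2 x) * (y - f3 x)
  + Num.max 0 (x - p.1) * (y - f3 x) + Num.max 0 (q.1 - x) * (y - f1 x).
have P1 x y : x <= q.1 -> phi x y = (y - l1 x) * ((y - q.2) ^+ 2 + (q.1 - x)).
  move=> xq; have xp : x <= p.1 by lra.
  rewrite /phi /f1 /f2 /f3 (min_idPl xp) (max_idPl xq) (max_idPr xq) l2q l3q.
  by rewrite (max_idPl _) ?(max_idPr _) ?subr_le0 ?subr_ge0 //; ring.
have P2 x y : q.1 <= x <= p.1 -> phi x y = (y - l1 x) * (y - l2 x) * (y - l3 x).
  move=> /andP[qx xp]; rewrite /phi /f1 /f2 /f3 (min_idPl xp) (max_idPr qx) (max_idPl qx).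
  by rewrite (max_idPl _) ?(max_idPl _) ?subr_le0 //; ring.
have P3 x y : p.1 <= x -> phi x y = (y - l3 x) * ((y - p.2) ^+ 2 + (x - p.1)).
  move=> px; have qx : q.1 <= x by lra.
  rewrite /phi /f1 /f2 /f3 (min_idPr px) (max_idPr (ltW qpl)) (max_idPl qx) l1p l2p.
  by rewrite (max_idPr _) ?(max_idPl _) ?subr_le0 ?subr_ge0 //; ring.
have pos x t : 0 < t -> 0 < x ^+ 2 + t by move=> t0; rewrite ltr_wpDl // sqr_ge0.
(* The bound must be strictly left of [q.1]: at [x = q.1] the second factor in [P1] vanishes for
   [y = q.2]. *)
exists phi, X, Y, l1, (q.1 - 1).
split=> [f g cf cg| |//|x y|x y xp].
- by rewrite /phi /f1 /f2 /f3 /l1 /l2 /l3; cont.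
- by [].
- rewrite chE; have [qx|xq] := leP q.1 x; last first.
    rewrite (P1 _ _ (ltW xq)); split=> [|/eqP].
      by case=> -[h ->]; [rewrite subrr mul0r|lra|lra].
    rewrite mulf_eq0 [X in _ || X]gt_eqF ?pos ?subr_gt0 // orbF subr_eq0 => /eqP ->.
    by apply: Or31; split=> //; lra.
  have [xp|px] := leP x p.1; last first.
    rewrite (P3 _ _ (ltW px)); split=> [|/eqP].
      by case=> -[h ->]; [lra|lra|rewrite subrr mul0r].
    rewrite mulf_eq0 [X in _ || X]gt_eqF ?pos ?subr_gt0 // orbF subr_eq0 => /eqP ->.
    by apply: Or33; split.
  rewrite P2 ?qx //; split=> [|/eqP].
    by case=> -[h ->]; rewrite subrr ?mulr0 ?mul0r.
  rewrite !mulf_eq0 !subr_eq0 orbT => /orP[/orP[]|] /eqP e.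
  + by apply: Or31.
  + by apply: Or32.
  + by apply: Or33.
have xq : x < q.1 by lra.
by rewrite (P1 _ _ (ltW xq)) sgrM (gtr0_sg (pos _ _ _)) ?mulr1 ?subr_gt0.
Qed.

Lemma chain_cases (p q u v : plane R) : u.1 != 0 -> v.1 != 0 -> p.1 != q.1 ->
  crossing (chain p q u v) \/ exists r a, wedge (chain p q u v) r a.
Proof.
move=> u0 v0 pq; move: u0 v0; rewrite !neq_lt => /orP[]u0 /orP[]v0.
- by right; apply: chain_wedge => //; rewrite nmulr_rgt0.
- by left; exact: chain_crossing.
- by left; rewrite chainC; apply: chain_crossing; rewrite // eq_sym.
- by right; apply: chain_wedge => //; rewrite pmulr_rgt0.
Qed.

(** * Shearing vertical directions away *)

Definition shear (c : R) (z : plane R) : plane R := (z.1 + c * z.2, z.2).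

(** A shear is linear and injective, so it acts alike on base points and directions and keeps the
    parameter [t]. *)
Lemma shear_chain c p q u v z :
  chain (shear c p) (shear c q) (shear c u) (shear c v) (shear c z) <-> chain p q u v z.
Proof.
have E (p' u' : plane R) t : shear c z = ((shear c p').1 + t * (shear c u').1,
   (shear c p').2 + t * (shear c u').2) <-> z = (p'.1 + t * u'.1, p'.2 + t * u'.2).
  case: z => x y; rewrite /shear /=; split=> [[e ye]|[-> ->]]; last by congr pair; ring.
  by rewrite ye in e *; congr pair; apply: (addIr (c * (p'.2 + t * u'.2))); rewrite e; ring.
have H (p' u' : plane R) : halfline (shear c p') (shear c u') (shear c z) <-> halfline p' u' z.
  by split=> -[t [t0 /E zt]]; exists t.
have S : segment (shear c p) (shear c q) (shear c z) <-> segment p q z.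
  have d : shear c (q.1 - p.1, q.2 - p.2) =
      ((shear c q).1 - (shear c p).1, (shear c q).2 - (shear c p).2).
    by rewrite /shear /=; congr pair; ring.
  have {}E t := E p (q.1 - p.1, q.2 - p.2) t; rewrite d /= in E.
  by split=> -[t [t0 /E zt]]; exists t.
by rewrite /chain /setU /= S !H.
Qed.


(** [c] exceeds every [|w.1 / w.2|], while a direction made vertical would have [w.1 / w.2 = - c].
    If [w.2 = 0] the shear fixes [w], whose first coordinate is then nonzero. *)
Lemma avoid_directions (s : seq (plane R)) : (forall w, w \in s -> w <> (0, 0)) ->
  exists c, forall w, w \in s -> (shear c w).1 != 0.
Proof.
move=> s0; pose c := 1 + \sum_(w <- s) `|w.1 / w.2|; exists c => w ws; apply/eqP => /= e.
have w2 : w.2 != 0.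
  apply/eqP => w2; apply: (s0 w ws); move: e; rewrite w2 mulr0 addr0 => w1.
  by move: w1 w2; case: (w) => /= ? ? -> ->.
have : `|w.1 / w.2| < c.
  rewrite /c (big_rem w ws) /= addrCA ltrDl addrC ltr_wpDl //.
  by apply: sumr_ge0.
rewrite (_ : w.1 / w.2 = - c) ?normrN.
  by rewrite ltNge ler_norm.
have -> : w.1 = - (c * w.2) by lra.
by field.
Qed.

(** * The bound for families of crossings and wedges *)

Section Family.
Variables (T : finType) (G : T -> set (plane R)).
Hypothesis GP : forall i, crossing (G i) \/ exists r a, wedge (G i) r a.
Local Notation e := (disjointness_graph G).

Lemma disjointness_graphE i j : e i j <-> i != j /\ disj (G i) (G j).
Proof.
split=> [/andP[ij /asboolP d]|[ij d]].
  by split=> // x y Gi Gj; suff : set0 (x, y) by []; rewrite -d.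
apply/andP; split=> //; apply/asboolP/seteqP; split=> // -[x y] [Gi Gj].
exact: d Gi Gj.
Qed.

Lemma family_bound :
  (chromatic_number e <= clique_number e ^ 3 + clique_number e)%N.
Proof.
pose P i := `[< crossing (G i) >].
(* [k i] records the direction and boundary of a wedge; [(true, 0)] is a dummy value for
   crossings. *)
have /choice[k kP] i : exists k : bool * R, ~~ P i -> wedge (G i) k.1 k.2.
  have [cr|[r [a w]]] := GP i; last by exists (r, a).
  by exists (true, 0) => /asboolP.
(* Nonempty members make disjointness imply distinct indices, as an edge demands. *)
have ne i : exists x y, G i (x, y).
  have [/crossing_left[L [M H]]|[r [a w]]] := GP i.
    by exists M, (L M); apply/H.
  by exists a; apply: (side_wedge w); case: (r) => /=.
pose le_k i j := le_end (k i).1 (k i).2 (k j).1 (k j).2.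
pose lt0 i j := [&& P i, P j & `[< over (G i) (G j) >]].
pose lt1 i j := `[< inside (G i) (G j) >].
pose lt2 i j := [&& ~~ P i, ~~ P j, le_k i j & `[< above (G i) (G j) >]].
pose lt3 i j := [&& ~~ P i, ~~ P j, le_k j i & `[< above (G i) (G j) >]].
have le_kT i j l : le_k i j -> le_k j l -> le_k i l by exact: le_end_trans.
have mid i j l : ~~ P i -> ~~ P j -> ~~ P l -> le_k i j -> le_k j l ->
    forall x y y', G i (x, y) -> G l (x, y') -> exists y'', G j (x, y'').
  move=> /kP wi /kP wj /kP wl ij jl x y y' /(wedge_side wi) xi /(wedge_side wl) xl.
  exact/(side_wedge wj)/(side_middle ij jl).
have disj_e i j : disj (G i) (G j) -> e i j.
  move=> d; apply/disjointness_graphE; split => //; apply/eqP => ij.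
  by have [x [y Gi]] := ne i; apply: (d x y) => //; rewrite -ij.
apply: (@chromatic_number_orders _ _ P lt0 lt1 lt2 lt3).
- by move=> i; rewrite /disjointness_graph eqxx.
- by move=> i j; rewrite /disjointness_graph eq_sym setIC.
- move=> j i l /and3P[Pi Pj /asboolP ij] /and3P[_ Pl /asboolP jl].
  apply/and3P; split=> //; apply/asboolP.
  move: Pi Pj Pl => /asboolP ci /asboolP cj /asboolP cl; exact: over_trans ij jl.
- move=> j i l /asboolP ij /asboolP jl; apply/asboolP; exact: inside_trans jl.
- move=> j i l /and4P[Pi Pj ij /asboolP aij] /and4P[_ Pl jl /asboolP ajl].
  apply/and4P; split=> //; first exact: le_kT jl.
  by apply/asboolP/(above_trans _ aij ajl); exact: mid.
- move=> j i l /and4P[Pi Pj ji /asboolP aij] /and4P[_ Pl lj /asboolP ajl].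
  apply/and4P; split=> //; first exact: le_kT ji.
  apply/asboolP/(above_trans _ aij ajl) => x y y' Gi Gl.
  exact: (mid l j i) Gl Gi.
- by move=> i j /and3P[_ _ /asboolP[/disj_e]].
- by move=> i j /asboolP/inside_disj/disj_e.
- by move=> i j /and4P[_ _ _ /asboolP/above_disj/disj_e].
- by move=> i j /and4P[_ _ _ /asboolP/above_disj/disj_e].
- move=> i j Pi Pj /disjointness_graphE[_ d]; rewrite /lt0 Pi Pj /=.
  move: Pi Pj => /asboolP ci /asboolP cj.
  by have [o|o] := over_total ci cj d; apply/orP; [left|right]; apply/asboolP.
(* [le_k] is total and the three alternatives are symmetric in [i] and [j]. *)
move=> i j Pi Pj; wlog ji : i j Pi Pj / le_k j i => [H|].
  have /orP[|ij] : le_k j i || le_k i j; first last.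
  - move=> eij; have eji : e j i by rewrite /disjointness_graph eq_sym setIC.
    have [] := H j i Pj Pi ij eji; rewrite orbC => ?.
    + exact: Or31.
    + exact: Or32.
    + exact: Or33.
  - exact: H.
  by rewrite /le_k /le_end; case: (k i).1 (k j).1 => [] [] //=; rewrite le_total.
move=> /disjointness_graphE[_ d].
suff [a|a|a] : [\/ above (G i) (G j), above (G j) (G i) |
    inside (G i) (G j) \/ inside (G j) (G i)].
- by apply: Or33; rewrite /lt3 Pi Pj ji /=; apply/orP; left; apply/asboolP.
- by apply: Or32; rewrite /lt2 Pi Pj ji /=; apply/orP; right; apply/asboolP.
- by apply: Or31; apply/orP; case: a => a; [left|right]; apply/asboolP.
have wi := kP i Pi; have wj := kP j Pj; move: ji wi wj; rewrite /le_k /le_end.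
(* A left wedge [G i] with a right wedge [G j] contradicts [le_k j i]. For two left wedges the
   smaller half-plane is that of [G j], so the roles are exchanged. *)
case: (k i) (k j) => [[] a] [[] b] //= ba wi wj.
- by have [] := wedge_same wi wj ba d; [apply: Or31|apply: Or32|move=> ?; apply: Or33; left].
- by have [] := wedge_opposite wi wj d; [apply: Or31|apply: Or32].
- by have [] := wedge_same wj wi ba (disjC d);
    [apply: Or32|apply: Or31|move=> ?; apply: Or33; right].
Qed.
End Family.

(** One shear serves all chains, since finitely many directions have to be avoided; being a
    bijection of the plane, it preserves disjointness. *)
Lemma nonvertical_family (T : finType) (F : T -> set (plane R)) :
  (forall i, is_3chain (F i)) ->
  exists G : T -> set (plane R),
    (forall i, crossing (G i) \/ exists r a, wedge (G i) r a) /\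
    disjointness_graph F = disjointness_graph G.
Proof.
move=> FP.
have /choice[d dP] i : exists d : plane R * plane R * (plane R * plane R),
    [/\ d.1.1 <> d.1.2, d.2.1 <> (0, 0), d.2.2 <> (0, 0) &
        F i = chain d.1.1 d.1.2 d.2.1 d.2.2].
  by have [p [q [u [v [pq [u0 [v0 ->]]]]]]] := FP i; exists ((p, q), (u, v)).
pose dirs i := [:: ((d i).1.2.1 - (d i).1.1.1, (d i).1.2.2 - (d i).1.1.2);
  (d i).2.1; (d i).2.2].
have [|c cP] := @avoid_directions (flatten [seq dirs i | i <- enum T]).
  move=> w /flatten_mapP[i _]; have [pq u0 v0 _] := dP i.
  rewrite !inE => /or3P[] /eqP -> // -[/eqP + /eqP]; rewrite !subr_eq0 => /eqP e1 /eqP e2.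
  by apply: pq; move: e1 e2; case: (d i).1 => [[? ?] [? ?]] /= -> ->.
have {}cP i w : w \in dirs i -> (shear c w).1 != 0.
  by move=> wi; apply: cP; apply/flatten_mapP; exists i; rewrite ?mem_enum.
pose G i := chain (shear c (d i).1.1) (shear c (d i).1.2)
  (shear c (d i).2.1) (shear c (d i).2.2).
have FG i z : G i (shear c z) <-> F i z by have [_ _ _ ->] := dP i; exact: shear_chain.
exists G; split=> [i|].
  apply: chain_cases.
  - by apply: (cP i); rewrite !inE eqxx orbT.
  - by apply: (cP i); rewrite !inE eqxx !orbT.
  have := cP i _ (mem_head _ _); rewrite /shear /=.
  by apply: contra_neq => e; lra.
apply/funext => i; apply/funext => j; rewrite /disjointness_graph; congr (_ && _).
apply: asbool_equiv_eq; split=> /seteqP[d0 _]; apply/seteqP; split=> // z [zi zj].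
  (* The witness is the preimage of [z] under the shear. *)
  apply: (d0 (z.1 - c * z.2, z.2)); split; apply/FG; rewrite /shear /= subrK;
    by [case: (z) zi|case: (z) zj].
by apply: (d0 (shear c z)); split; apply/FG.
Qed.
End Plane.

Theorem theorem5 (R : realType) (T : finType) (F : T -> set (plane R)) :
  (forall i, is_3chain (F i)) ->
  (chromatic_number (disjointness_graph F) <=
     clique_number (disjointness_graph F) ^ 3
     + clique_number (disjointness_graph F))%N.
Proof.
by move=> /nonvertical_family[G [GP ->]]; exact: family_bound.
Qed.
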